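(* Let $E,F\in\mathbb C^{n\times m}$ and let $P(s)=sE-F$ be a matrix pencil with Weyr characteristic $w(P)=(w,a,b,c)$. Let $(W,A,B,C)$ be the Weyr characteristic of the linear relation $FE^{-1}:=\{(Ex,Fx): x\in\mathbb C^m\}$ in $\mathbb C^n$ (the range representation of $P$). Then $$W=w,\qquad A=a,$$ and, if $b=(b_1,\ldots,b_{n_b})$ and $c=(c_1,\ldots,c_{n_c})$, then $$B=(b_2,\ldots,b_{n_b})\qquad\text{and}\qquad C=(c_2,\ldots,c_{n_c})$$ (empty sequences if $n_b\le1$, respectively $n_c\le 1$).
   Context: **Linear relations.** A linear relation in a finite-dimensional complex vector space $X$ is a linear subspace $S$ of $X\times X$. Put $\operatorname{dom}S=\{x:(x,y)\in S \text{ for some }y\}$, $R(S)=\{y:(x,y)\in S\text{ for some }x\}$, $N(S)=\{x:(x,0)\in S\}$, $\operatorname{mul}(S)=\{y:(0,y)\in S\}$, $S-\lambda=\{(x,y-\lambda x):(x,y)\in S\}$ for $\lambda\in\mathbb C$. The product is $S_1S_2=\{(x,z): (x,y)\in S_2,\ (y,z)\in S_1\text{ for some }y\}$; $S^0=I$ is the identity relation and $S^k=S\cdot S^{k-1}$. For $\lambda\in\mathbb C$ let $\mathcal R_\lambda(S)=\bigcup_{k}N((S-\lambda)^k)$, $\mathcal R_\infty(S)=\bigcup_k\operatorname{mul}(S^k)$, and $\mathcal R_c(S)=\mathcal R_0(S)\cap\mathcal R_\infty(S)$. A number $\lambda\in\mathbb C$ is an eigenvalue of $S$ if $N(S-\lambda)\ne\{0\}$,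 and $\infty$ is an eigenvalue if $\operatorname{mul}(S)\neq\{0\}$; an eigenvalue $\lambda\in\mathbb C\cup\{\infty\}$ is proper if $\mathcal R_\lambda(S)\not\subset\mathcal R_c(S)$. **Weyr characteristic of a linear relation.** For $k\ge1$ and $\lambda\in\mathbb C$ set $$W_k(S,\lambda)=\dim\frac{N((S-\lambda)^k)+\mathcal R_c(S)}{N((S-\lambda)^{k-1})+\mathcal R_c(S)},\quad A_k=\dim\frac{\operatorname{mul}(S^k)+\mathcal R_c(S)}{\operatorname{mul}(S^{k-1})+\mathcal R_c(S)},\quad B_k=\dim\frac{N(S^k)\cap\mathcal R_c(S)}{N(S^{k-1})\cap\mathcal R_c(S)},$$ $$C_1=\dim\frac{R(S)+\operatorname{dom}S}{R(S)+\mathcal R_0(S)},\qquad C_k=\dim\frac{R(S^{k})+\mathcal R_0(S)}{R(S^{k+1})+\mathcal R_0(S)}\quad(k\ge2).$$ These sequences are non-increasing and eventually zero; they are regarded as finite sequences by omitting zero entries (possibly empty). $W$ is the collection of the sequences $W(\lambda)=(W_k(S,\lambda))_k$ indexed by the finite proper eigenvalues $\lambda$ of $S$, and $(W,A,B,C)$ with $A=(A_k)$, $B=(B_k)$, $C=(C_k)$ is the Weyr characteristic of $S$. **Weyr characteristic of a pencil.** For $k\ge1$ let $N_k\in\mathbb C^{k\times k}$ have ones on the first subdiagonal and zeros elsewhere, and let $K_k=[I_{k-1}\ 0]$, $L_k=[0\ I_{k-1}]\in\mathbb C^{(k-1)\times k}$ (for $k=1$ these are $0\times1$ matrices, contributing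 just a zero column to a block diagonal matrix, and their transposes contribute just a zero row). For a multi-index $\alpha=(\alpha_1,\dots,\alpha_l)$ of positive integers, $|\alpha|=\sum_i\alpha_i$ and $N_\alpha,K_\alpha,L_\alpha$ are the block diagonal matrices with blocks $N_{\alpha_i},K_{\alpha_i},L_{\alpha_i}$. Every pencil $sE-F$ with $E,F\in\mathbb C^{n\times m}$ admits invertible $V\in\mathbb C^{n\times n}$, $U\in\mathbb C^{m\times m}$ with $$V(sE-F)U=\operatorname{diag}\big(sI_{n_0}-J_0,\ sN_\alpha-I_{|\alpha|},\ sK_\beta-L_\beta,\ sK_\gamma^\top-L_\gamma^\top\big)$$ (Kronecker canonical form), where $J_0$ is in Jordan normal form and $\alpha,\beta,\gamma$ are non-increasing multi-indices (any block may be absent), unique up to permutation of the Jordan blocks of $J_0$. The Weyr characteristic $w(P)=(w,a,b,c)$ is: $w$ is the collection, indexed by the eigenvalues $\lambda$ of $J_0$, of the sequences $w(\lambda)=(w_k(\lambda))_k$, $w_k(\lambda)=\dim N((J_0-\lambda)^k)-\dim N((J_0-\lambda)^{k-1})$; $a,b,c$ are the conjugate partitions of $\alpha,\beta,\gamma$, i.e. $a_k=\#\{i:\alpha_i\ge k\}$, and similarly for $b,c$ (zero entries omitted). The equality $W=w$ means that the finite proper eigenvalues of the relation are the eigenvalues of $J_0$ and that the sequences at each of them agree. *)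

(* Defs.v *)
From HB Require Import structures.
From mathcomp Require Import all_boot all_order all_algebra.

Set Implicit Arguments.
Unset Strict Implicit.
Unset Printing Implicit Defensive.

Import GRing.Theory.

Local Open Scope ring_scope.

(* [omit0 d f] is f 1, f 2, ... with zero entries omitted.  The bound [d] only
   makes the list computable: every use below has f k = 0 for all k > d. *)
Definition omit0 (d : nat) (f : nat -> nat) : seq nat :=
  [seq x <- [seq f k | k <- iota 1 d] | x != 0%N].

Section LinearRelations.

Variables (K : fieldType) (X : vectType K).

Implicit Types (S : {vspace X * X}) (U : {vspace X}) (l : K) (x y z : X).

Definition lr_dom S : {vspace X} := (linfun fst @: S)%VS.

Definition lr_ran S : {vspace X} := (linfun snd @: S)%VS.

Definition lr_ker S : {vspace X} :=
  (linfun (fun x : X => (x, 0 : X)) @^-1: S)%VS.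

Definition lr_mul S : {vspace X} :=
  (linfun (fun y : X => (0 : X, y)) @^-1: S)%VS.

Definition lr_shift S l : {vspace X * X} :=
  (linfun (fun p : X * X => (p.1, p.2 - l *: p.1)) @: S)%VS.

(* The triples ((x, y), z) with (x, y) in S2 and (y, z) in S1, projected to
   (x, z). *)
Definition lr_comp (S1 S2 : {vspace X * X}) : {vspace X * X} :=
  (linfun (fun t : (X * X) * X => (t.1.1, t.2)) @:
     ((linfun (fun t : (X * X) * X => t.1) @^-1: S2) :&:
      (linfun (fun t : (X * X) * X => (t.1.2, t.2)) @^-1: S1)))%VS.

Definition lr_id : {vspace X * X} := limg (linfun (fun x : X => (x, x))).

Definition lr_pow S k : {vspace X * X} := iter k (lr_comp S) lr_id.

(* The increasing unions over k of N((S - l)^k) and mul(S^k) are attained at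
   k = dim X, see [mem_rootspace] and [mem_rootspace_oo]. *)
Definition rootspace S l : {vspace X} :=
  lr_ker (lr_pow (lr_shift S l) (\dim {:X})).

Definition rootspace_oo S : {vspace X} := lr_mul (lr_pow S (\dim {:X})).

Definition chainspace S : {vspace X} := (rootspace S 0 :&: rootspace_oo S)%VS.

Definition lr_eigenvalue S l : bool := lr_ker (lr_shift S l) != 0%VS.

Definition proper_eigenvalue S l : bool :=
  lr_eigenvalue S l && ~~ (rootspace S l <= chainspace S)%VS.

(* dim (U / V), used for V a subspace of U only. *)
Definition qdim (U V : {vspace X}) : nat := (\dim U - \dim V)%N.

Definition W_num S l k : nat :=
  qdim (lr_ker (lr_pow (lr_shift S l) k) + chainspace S)
       (lr_ker (lr_pow (lr_shift S l) k.-1) + chainspace S).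

Definition A_num S k : nat :=
  qdim (lr_mul (lr_pow S k) + chainspace S)
       (lr_mul (lr_pow S k.-1) + chainspace S).

Definition B_num S k : nat :=
  qdim (lr_ker (lr_pow S k) :&: chainspace S)
       (lr_ker (lr_pow S k.-1) :&: chainspace S).

Definition C_num S k : nat :=
  if k == 1%N then qdim (lr_ran S + lr_dom S) (lr_ran S + rootspace S 0)
  else qdim (lr_ran (lr_pow S k) + rootspace S 0)
            (lr_ran (lr_pow S k.+1) + rootspace S 0).

(* A collection of sequences indexed by a set of scalars is a function to
   [option (seq nat)], with value [None] exactly outside the index set. *)
Definition weyr_W S : K -> option (seq nat) := fun l =>
  if proper_eigenvalue S l then Some (omit0 (\dim {:X}) (W_num S l)) else None.

Definition weyr_A S : seq nat := omit0 (\dim {:X}) (A_num S).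

Definition weyr_B S : seq nat := omit0 (\dim {:X}) (B_num S).

Definition weyr_C S : seq nat := omit0 (\dim {:X}) (C_num S).

End LinearRelations.

Section Pencils.

Variable K : fieldType.

Definition pencil n m (E F : 'M[K]_(n, m)) (s : K) : 'M[K]_(n, m) :=
  s *: E - F.

Definition range_rep n m (E F : 'M[K]_(n, m)) :
    {vspace 'cV[K]_n * 'cV[K]_n} :=
  limg (linfun (fun x : 'cV[K]_m => (E *m x, F *m x))).

Definition N_mx k : 'M[K]_k := \matrix_(i, j) (i == j.+1 :> nat)%:R.

Definition K_mx k : 'M[K]_(k.-1, k) := \matrix_(i, j) (j == i :> nat)%:R.

Definition L_mx k : 'M[K]_(k.-1, k) := \matrix_(i, j) (j == i.+1 :> nat)%:R.

Definition jordan_block (mu : K) k : 'M[K]_k := mu%:M + (N_mx k)^T.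

(* The Jordan matrix with the blocks listed in [js] as pairs (eigenvalue,
   size). *)
Definition jordan_size (js : seq (K * nat)) (i : 'I_(size js)) : nat :=
  (nth (0, 0%N) js i).2.

Definition jordan_dim (js : seq (K * nat)) : nat :=
  \sum_(i < size js) jordan_size i.

Definition jordan_mx (js : seq (K * nat)) : 'M[K]_(jordan_dim js) :=
  \mxdiag_(i < size js) jordan_block (nth (0, 0%N) js i).1 (jordan_size i).

(* Rectangular matrices depending on the parameter s, of possibly zero height
   or width, and their block diagonal sum. *)
Record mxfun := MxFun {
  mf_rows : nat;
  mf_cols : nat;
  mf_val : K -> 'M[K]_(mf_rows, mf_cols) }.

Fixpoint bdiag (bs : seq mxfun) (s : K) :
    'M[K]_(sumn (map mf_rows bs), sumn (map mf_cols bs)) :=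
  match bs with
  | [::] => 0
  | b :: bs' => block_mx (mf_val b s) 0 0 (bdiag bs' s)
  end.

Definition kronecker_blocks (js : seq (K * nat)) (al be ga : seq nat) :
    seq mxfun :=
  MxFun (fun s => s%:M - jordan_mx js)
    :: [seq MxFun (fun s => s *: N_mx k - 1%:M) | k <- al]
    ++ [seq MxFun (fun s => s *: K_mx k - L_mx k) | k <- be]
    ++ [seq MxFun (fun s => s *: (K_mx k)^T - (L_mx k)^T) | k <- ga].

(* A possibly empty non-increasing multi-index of positive integers. *)
Definition multi_index (al : seq nat) : bool :=
  sorted geq al && all (ltn 0) al.

Definition kronecker_form n m (E F : 'M[K]_(n, m))
    (js : seq (K * nat)) (al be ga : seq nat) : Prop :=
  let bs := kronecker_blocks js al be ga in
  [/\ all (fun j => 0 < j.2)%N js,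
      [/\ multi_index al, multi_index be & multi_index ga] &
      exists (en : sumn (map mf_rows bs) = n) (em : sumn (map mf_cols bs) = m)
             (V : 'M[K]_n) (U : 'M[K]_m),
        [/\ V \in unitmx, U \in unitmx &
            forall s, V *m pencil E F s *m U = castmx (en, em) (bdiag bs s)]].

(* dim {x | A x = 0}, the kernel being that of A acting on columns. *)
Definition nullity n (A : 'M[K]_n) : nat := \rank (cokermx A).

Definition w_num n (J : 'M[K]_n) (l : K) k : nat :=
  (nullity ((J - l%:M) ^+ k) - nullity ((J - l%:M) ^+ k.-1))%N.

Definition weyr_w n (J : 'M[K]_n) : K -> option (seq nat) := fun l =>
  if eigenvalue J l then Some (omit0 n (w_num J l)) else None.

Definition conj_partition (al : seq nat) : seq nat :=
  omit0 (sumn al) (fun k => count (leq k) al).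

Definition weyr_pencil n m (E F : 'M[K]_(n, m))
    (w : K -> option (seq nat)) (a b c : seq nat) : Prop :=
  exists (js : seq (K * nat)) (al be ga : seq nat),
    [/\ kronecker_form E F js al be ga,
        w =1 weyr_w (jordan_mx js),
        a = conj_partition al,
        b = conj_partition be & c = conj_partition ga].

End Pencils.

Section RelationTheory.

Variables (K : fieldType) (X : vectType K).

Implicit Types (S T : {vspace X * X}) (U : {vspace X}) (l : K) (x y z : X).

Lemma linfunE (aT rT : vectType K) (f : aT -> rT) :
  linear f -> linfun f =1 f.
Proof.
move=> lf x; pose H := GRing.isLinear.Build K aT rT *:%R f lf.
pose g : {linear aT -> rT} := HB.pack f H.
exact: (lfunE g).
Qed.

Lemma linfunP (aT rT : vectType K) (f : aT -> rT) (V : {vspace aT}) v :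
  linear f -> reflect (exists2 u, u \in V & v = f u) (v \in (linfun f @: V)%VS).
Proof.
move=> lf; apply: (iffP memv_imgP) => -[u uV ->]; exists u => //;
  by rewrite linfunE.
Qed.

Lemma linfun_preim (aT rT : vectType K) (f : aT -> rT) (W : {vspace rT}) u :
  linear f -> (u \in (linfun f @^-1: W)%VS) = (f u \in W).
Proof. by move=> lf; rewrite -memv_preim linfunE. Qed.

Lemma mem_dom S x : reflect (exists y, (x, y) \in S) (x \in lr_dom S).
Proof.
apply: (iffP (linfunP _ _ _)) => //; first by case=> -[a b] abS ->; exists b.
by case=> y xyS; exists (x, y).
Qed.

Lemma mem_ran S y : reflect (exists x, (x, y) \in S) (y \in lr_ran S).
Proof.
apply: (iffP (linfunP _ _ _)) => //; first by case=> -[a b] abS ->; exists a.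
by case=> x xyS; exists (x, y).
Qed.

Lemma mem_ker S x : (x \in lr_ker S) = ((x, 0) \in S).
Proof.
rewrite linfun_preim // => a u v.
by congr pair; rewrite /= scaler0 addr0.
Qed.

Lemma mem_mul S y : (y \in lr_mul S) = ((0, y) \in S).
Proof.
rewrite linfun_preim // => a u v.
by congr pair; rewrite /= scaler0 addr0.
Qed.

Lemma mem_shift S l x y : ((x, y - l *: x) \in lr_shift S l) = ((x, y) \in S).
Proof.
apply/linfunP/idP => [a [u1 u2] [v1 v2]||xyS]; last by exists (x, y).
  congr pair; rewrite /= scalerBr scalerDr !scalerA opprD addrACA.
  by rewrite [l * a]mulrC.
by case=> -[a b] abS /= [-> /addIr ->].
Qed.

Lemma mem_comp S1 S2 x z :
  reflect (exists2 y, (x, y) \in S2 & (y, z) \in S1) ((x, z) \in lr_comp S1 S2).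
Proof.
apply: (iffP (linfunP _ _ _)) => //.
  case=> -[[a y] b]; rewrite memv_cap !linfun_preim //= => /andP[H2 H1] [-> ->].
  by exists y.
case=> y H2 H1; exists ((x, y), z) => //.
by rewrite memv_cap !linfun_preim // H2.
Qed.

Lemma mem_id x y : ((x, y) \in lr_id X) = (x == y).
Proof.
apply/linfunP/eqP => //; first by case=> u _ [-> ->].
by move=> ->; exists y; rewrite ?memvf.
Qed.

Lemma mem_pow0 S x y : ((x, y) \in lr_pow S 0) = (x == y).
Proof. exact: mem_id. Qed.

Lemma mem_powS S k x z :
  reflect (exists2 y, (x, y) \in lr_pow S k & (y, z) \in S)
          ((x, z) \in lr_pow S k.+1).
Proof. exact: mem_comp. Qed.

Lemma mem_powSr S k x z :
  reflect (exists2 y, (x, y) \in S & (y, z) \in lr_pow S k)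
          ((x, z) \in lr_pow S k.+1).
Proof.
elim: k x z => [|k IH] x z.
  apply: (iffP (mem_powS _ _ _ _)) => -[y].
    by rewrite mem_pow0 => /eqP<- xz; exists z; rewrite ?mem_pow0.
  by move=> xy; rewrite mem_pow0 => /eqP<-; exists x; rewrite ?mem_pow0.
apply: (iffP (mem_powS _ _ _ _)) => -[y].
  by move=> /IH[u xu uy] yz; exists u => //; apply/mem_powS; exists y.
move=> xy /mem_powS[u yu uz]; exists u => //; apply/IH; by exists y.
Qed.

Lemma iter_stable (f : {vspace X} -> {vspace X}) U0 k j :
  iter k.+1 f U0 = iter k f U0 -> (k <= j)%N -> iter j f U0 = iter k f U0.
Proof.
move=> e /subnK <-; elim: (j - k)%N => // i IH.
by rewrite addSn iterS IH -iterS e.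
Qed.

Lemma iter_up (f : {vspace X} -> {vspace X}) :
    (forall U V, (U <= V)%VS -> (f U <= f V)%VS) ->
  forall k, (\dim {:X} <= k)%N -> iter k f 0%VS = iter (\dim {:X}) f 0%VS.
Proof.
move=> fmono k; apply: iter_stable.
have up i : (iter i f 0 <= iter i.+1 f 0)%VS.
  by elim: i => [|i IH]; [exact: sub0v | exact: fmono].
have H i : iter i.+1 f 0%VS = iter i f 0%VS \/ (i < \dim (iter i.+1 f 0%VS))%N.
  elim: i => [|i [e|lt]]; last 2 first.
  - by left; rewrite [in LHS]iterS e.
  - have [e|ne] := eqVneq (iter i.+2 f 0%VS) (iter i.+1 f 0%VS); first by left.
    right; apply: leq_ltn_trans lt _; rewrite ltnNge; apply: contraNN ne => le.
    by rewrite eq_sym eqEdim up.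
  have [e|ne] := eqVneq (iter 1 f 0%VS) (iter 0 f 0%VS); first by left.
  by right; rewrite lt0n dimv_eq0.
by case: (H (\dim {:X})) => //; rewrite ltnNge dimvS ?subvf.
Qed.

Lemma iter_down (f : {vspace X} -> {vspace X}) :
    (forall U V, (U <= V)%VS -> (f U <= f V)%VS) ->
  forall k, (\dim {:X} <= k)%N ->
  iter k f fullv = iter (\dim {:X}) f fullv.
Proof.
move=> fmono k; apply: iter_stable.
have dn i : (iter i.+1 f fullv <= iter i f fullv)%VS.
  by elim: i => [|i IH]; [exact: subvf | exact: fmono].
have H i : iter i.+1 f fullv = iter i f fullv \/
           (\dim (iter i.+1 f fullv) + i < \dim {:X})%N.
  elim: i => [|i [e|lt]]; last 2 first.
  - by left; rewrite [in LHS]iterS e.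
  - have [e|ne] := eqVneq (iter i.+2 f fullv) (iter i.+1 f fullv); first by left.
    right; rewrite addnS; apply: leq_trans lt; rewrite ltnS ltn_add2r ltnNge.
    by apply: contraNN ne => le; rewrite eqEdim dn.
  have [e|ne] := eqVneq (iter 1 f fullv) (iter 0 f fullv); first by left.
  right; rewrite addn0 ltnNge; apply: contraNN ne => le.
  by rewrite eqEdim dn.
case: (H (\dim {:X})) => //.
by rewrite ltnNge leq_addl.
Qed.

Definition lr_image S U : {vspace X} :=
  (linfun snd @: (S :&: (linfun fst @^-1: U)))%VS.

Definition lr_preimage S U : {vspace X} :=
  (linfun fst @: (S :&: (linfun snd @^-1: U)))%VS.

Lemma mem_image S U y :
  reflect (exists2 x, x \in U & (x, y) \in S) (y \in lr_image S U).
Proof.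
apply: (iffP (linfunP _ _ _)) => //.
  case=> -[a b]; rewrite memv_cap linfun_preim //= => /andP[H1 H2] ->.
  by exists a.
by case=> x xU xy; exists (x, y); rewrite // memv_cap linfun_preim // xy.
Qed.

Lemma mem_preimage S U x :
  reflect (exists2 y, y \in U & (x, y) \in S) (x \in lr_preimage S U).
Proof.
apply: (iffP (linfunP _ _ _)) => //.
  case=> -[a b]; rewrite memv_cap linfun_preim //= => /andP[H1 H2] ->.
  by exists b.
by case=> y yU xy; exists (x, y); rewrite // memv_cap linfun_preim // xy.
Qed.

Lemma image_mono S U V : (U <= V)%VS -> (lr_image S U <= lr_image S V)%VS.
Proof.
move=> UV; apply/subvP => y /mem_image[x xU xy]; apply/mem_image.
by exists x => //; apply: (subvP UV).
Qed.

Lemma preimage_mono S U V :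
  (U <= V)%VS -> (lr_preimage S U <= lr_preimage S V)%VS.
Proof.
move=> UV; apply/subvP => y /mem_preimage[x xU xy]; apply/mem_preimage.
by exists x => //; apply: (subvP UV).
Qed.

Lemma ker_powE S k : lr_ker (lr_pow S k) = iter k (lr_preimage S) 0%VS.
Proof.
elim: k => [|k IH]; first by apply/vspaceP => x; rewrite mem_ker mem_pow0 memv0.
apply/vspaceP => x; rewrite iterS -IH mem_ker.
by apply/mem_powSr/mem_preimage => -[y]; rewrite ?mem_ker; exists y;
  rewrite ?mem_ker.
Qed.

Lemma mul_powE S k : lr_mul (lr_pow S k) = iter k (lr_image S) 0%VS.
Proof.
elim: k => [|k IH].
  by apply/vspaceP => x; rewrite mem_mul mem_pow0 memv0 eq_sym.
apply/vspaceP => x; rewrite iterS -IH mem_mul.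
by apply/mem_powS/mem_image => -[y]; rewrite ?mem_mul; exists y;
  rewrite ?mem_mul.
Qed.

Lemma ran_powE S k : lr_ran (lr_pow S k) = iter k (lr_image S) fullv.
Proof.
elim: k => [|k IH].
  apply/vspaceP => x; rewrite memvf; apply/mem_ran; exists x.
  by rewrite mem_pow0.
apply/vspaceP => z; rewrite iterS -IH; apply/mem_ran/mem_image.
  by case=> x /mem_powS[y xy yz]; exists y => //; apply/mem_ran; exists x.
by case=> y /mem_ran[x xy] yz; exists x; apply/mem_powS; exists y.
Qed.

Lemma ker_pow_stable S k : (\dim {:X} <= k)%N ->
  lr_ker (lr_pow S k) = lr_ker (lr_pow S (\dim {:X})).
Proof. by move=> le; rewrite !ker_powE iter_up //; apply: preimage_mono. Qed.

Lemma mul_pow_stable S k : (\dim {:X} <= k)%N ->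
  lr_mul (lr_pow S k) = lr_mul (lr_pow S (\dim {:X})).
Proof. by move=> le; rewrite !mul_powE iter_up //; apply: image_mono. Qed.

Lemma ran_pow_stable S k : (\dim {:X} <= k)%N ->
  lr_ran (lr_pow S k) = lr_ran (lr_pow S (\dim {:X})).
Proof. by move=> le; rewrite !ran_powE iter_down //; apply: image_mono. Qed.

Lemma ker_pow_mono S k j : (k <= j)%N ->
  (lr_ker (lr_pow S k) <= lr_ker (lr_pow S j))%VS.
Proof.
move/subnK<-; elim: (j - k)%N => [|i IH]; first exact: subvv.
apply: subv_trans IH _; rewrite addSn !ker_powE.
elim: (i + k)%N => [|h IH]; [exact: sub0v | exact: preimage_mono].
Qed.

Lemma mul_pow_mono S k j : (k <= j)%N ->
  (lr_mul (lr_pow S k) <= lr_mul (lr_pow S j))%VS.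
Proof.
move/subnK<-; elim: (j - k)%N => [|i IH]; first exact: subvv.
apply: subv_trans IH _; rewrite addSn !mul_powE.
elim: (i + k)%N => [|h IH]; [exact: sub0v | exact: image_mono].
Qed.

Lemma mem_rootspace S l x :
  x \in rootspace S l <-> exists k, x \in lr_ker (lr_pow (lr_shift S l) k).
Proof.
split=> [H|[k xk]]; first by exists (\dim {:X}).
have /subvP := ker_pow_mono (lr_shift S l) (leq_addr (\dim {:X}) k).
by move/(_ _ xk); rewrite ker_pow_stable ?leq_addl.
Qed.

Lemma mem_rootspace_oo S x :
  x \in rootspace_oo S <-> exists k, x \in lr_mul (lr_pow S k).
Proof.
split=> [H|[k xk]]; first by exists (\dim {:X}).
have /subvP := mul_pow_mono S (leq_addr (\dim {:X}) k).
by move/(_ _ xk); rewrite mul_pow_stable ?leq_addl.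
Qed.

Lemma W_num_big S l k : (\dim {:X} < k)%N -> W_num S l k = 0%N.
Proof.
by case: k => // k le; rewrite /W_num !ker_pow_stable ?leqW // /qdim subnn.
Qed.

Lemma A_num_big S k : (\dim {:X} < k)%N -> A_num S k = 0%N.
Proof.
by case: k => // k le; rewrite /A_num !mul_pow_stable ?leqW // /qdim subnn.
Qed.

Lemma B_num_big S k : (\dim {:X} < k)%N -> B_num S k = 0%N.
Proof.
by case: k => // k le; rewrite /B_num !ker_pow_stable ?leqW // /qdim subnn.
Qed.

Lemma C_num_big S k : (\dim {:X} < k)%N -> C_num S k = 0%N.
Proof.
move=> le; rewrite /C_num; case: eqP => [e|_].
  apply/eqP; rewrite subn_eq0.
  by rewrite (leq_trans (dimvS (subvf _))) // -ltnS (leq_trans le) // e.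
by rewrite !ran_pow_stable ?leqW ?(ltnW le) // /qdim subnn.
Qed.

End RelationTheory.

Lemma conj_partition_big al k : (sumn al < k)%N -> count (leq k) al = 0%N.
Proof.
move=> le; apply/eqP; rewrite -leqn0 leqNgt -has_count; apply/hasP => -[x xal kx].
have : (x <= sumn al)%N.
  elim: {le} al xal => //= y al IH; rewrite inE => /orP[/eqP->|/IH h].
    exact: leq_addr.
  exact: leq_trans h (leq_addl _ _).
by rewrite leqNgt (leq_trans le).
Qed.

Lemma mem_range_rep (K : fieldType) n m (E F : 'M[K]_(n, m)) u v :
  reflect (exists x, u = E *m x /\ v = F *m x) ((u, v) \in range_rep E F).
Proof.
apply: (iffP (linfunP _ _ _)).
- by move=> a x y; congr pair; rewrite /= mulmxDr scalemxAr.
- by case=> x _ [-> ->]; exists x.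
- by case=> x [-> ->]; exists x; rewrite ?memvf.
Qed.

Lemma w_num_big (K : fieldType) n (J : 'M[K]_n) (l : K) k :
  (n < k)%N -> w_num J l k = 0%N.
Proof.
rewrite /w_num; set A := J - l%:M.
have dn i : (A ^+ i.+1 <= A ^+ i)%MS by rewrite exprS submxMl.
have H i : (A ^+ i <= A ^+ i.+1)%MS || (\rank (A ^+ i.+1)%R + i < n)%N.
  elim: i => [|i /orP[le|lt]].
  - case le: (_ <= _)%MS => //=; rewrite addn0.
    have := rank_leq_row (A ^+ 1); rewrite leq_eqVlt => /orP[/eqP e|//].
    by case/negP: (negbT le); rewrite -mxrank_leqif_sup // e expr0 mxrank1.
  - by rewrite exprSr [X in (_ <= X)%MS]exprSr submxMr.
  case le: (_ <= _)%MS => //=.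
  have : (\rank (A ^+ i.+2)%R < \rank (A ^+ i.+1)%R)%N.
    rewrite ltn_neqAle mxrankS ?dn // andbT.
    by rewrite (mxrank_leqif_sup (dn _)) le.
  by move=> lt'; rewrite addnS; apply: leq_trans lt; rewrite ltnS ltn_add2r.
have st i : (n <= i)%N -> (A ^+ i <= A ^+ i.+1)%MS.
  by move=> le; case/orP: (H i) => //; rewrite ltnNge (leq_trans le) ?leq_addl.
case: k => // k le; rewrite /nullity !mxrank_coker /=; apply/eqP.
by rewrite subn_eq0 leq_sub2l // mxrankS ?st.
Qed.

(* Main.v *)
Require Import Defs.
From mathcomp Require Import all_boot all_order all_algebra.
From mathcomp Require Import zify.
From mathcomp Require Import reals complex.

(** Every number in the Weyr characteristic of a relation is a difference of
    dimensions of spaces built from kernels, ranges, domains and multivalued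
    parts of powers by sums and intersections.  All these operations respect
    direct sums of relations, so each of the numbers is additive
    ([W_num_split], [A_num_split], [B_num_split], [C_num_split]).

    If V (sE - F) U is block diagonal, then x |-> V x carries F E^-1 onto the
    direct sum of the relations defined by the blocks
    ([additive_number_kronecker]), and it remains to read off the numbers of
    one block of each kind:
    - s - J gives the graph of J.  Nothing is multivalued, so only W is
      nonzero, and it consists of the jumps of the nullities of (J - l)^k.  The
      vanishing of C is Fitting's decomposition.
    - s N - 1 gives the inverse of the nilpotent shift N.  It is surjective and
      has no finite eigenvalue; mul (S^k) is the kernel of N^k, so a block of
      size k0 contributes 1 to A_k for k <= k0.
    - s K - L with k0 columns gives, in dimension k0 - 1, the backward shift
      whose last entry is left free.  Every vector lies on a chain from 0 to 0,
      so the chain space is everything; modulo it W and A vanish, and B counts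
      the filtration by the kernels of the powers, of length k0 - 1.
    - s K^T - L^T with k0 rows gives, in dimension k0, the forward shift defined
      on the vectors with last entry 0.  It is injective and single valued, so
      only C is left.  The ranges of the powers form a filtration with k0
      one-dimensional layers, and C leaves out one of them: R(S) / R(S^2) when
      k0 > 1, and the only layer when k0 = 1, since the domain and the range
      are then both zero.

    The lengths k0 - 1 in the last two cases are why B and C are b and c with
    their first entries removed. *)

Import GRing.Theory.
Local Open Scope ring_scope.

(** * General facts on linear relations *)

Section RelationFacts.

Set Implicit Arguments.
Unset Strict Implicit.

Variables (K : fieldType) (X : vectType K).
Implicit Types (S : {vspace X * X}) (l : K) (x y : X).

Lemma mem_shiftD S l x y :
  ((x, y) \in lr_shift S l) = ((x, y + l *: x) \in S).
Proof. by rewrite -(mem_shift S l) addrK. Qed.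

Lemma shift0 S : lr_shift S 0 = S.
Proof. by apply/vspaceP => -[x y]; rewrite mem_shiftD scale0r addr0. Qed.

Lemma pow1 S : lr_pow S 1 = S.
Proof.
apply/vspaceP => -[x y]; apply/mem_powS/idP => [[z]|xy].
  by rewrite mem_pow0 => /eqP<-.
by exists x; rewrite ?mem_pow0.
Qed.

Lemma ker_pow_sub_rootspace S l k :
  (lr_ker (lr_pow (lr_shift S l) k) <= rootspace S l)%VS.
Proof. by apply/subvP => x xk; apply/mem_rootspace; exists k. Qed.

(** The dimension of the whole space in the definition of the root spaces can be
    replaced by any larger exponent; so the root spaces of a direct sum and of
    its summands can be taken at the same exponent. *)
Lemma rootspaceE S l k : (\dim {:X} <= k)%N ->
  rootspace S l = lr_ker (lr_pow (lr_shift S l) k).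
Proof. by move=> le; rewrite ker_pow_stable. Qed.

Lemma rootspace_ooE S k : (\dim {:X} <= k)%N ->
  rootspace_oo S = lr_mul (lr_pow S k).
Proof. by move=> le; rewrite mul_pow_stable. Qed.

Lemma ran_pow_mono S k j : (k <= j)%N ->
  (lr_ran (lr_pow S j) <= lr_ran (lr_pow S k))%VS.
Proof.
move/subnK<-; elim: (j - k)%N => [|i IH]; first exact: subvv.
apply: subv_trans IH; rewrite addSn !ran_powE.
elim: (i + k)%N => [|h IH]; [exact: subvf | exact: image_mono].
Qed.

Lemma rootspace_sub_dom S : (rootspace S 0 <= lr_dom S)%VS.
Proof.
rewrite /rootspace shift0; apply/subvP => x; rewrite mem_ker.
case: (\dim _) => [|k]; first by rewrite mem_pow0 => /eqP->; rewrite mem0v.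
by case/mem_powSr => y xy _; apply/mem_dom; exists y.
Qed.

Lemma ker_pow_eq0 S k : lr_ker S = 0%VS -> lr_ker (lr_pow S k) = 0%VS.
Proof.
move=> S0; elim: k => [|k IH]; apply/vspaceP => x; rewrite memv0 mem_ker.
  by rewrite mem_pow0.
apply/mem_powSr/eqP => [[y xy]|->]; last by exists 0; rewrite ?mem0v.
rewrite -mem_ker IH memv0 => /eqP y0; apply/eqP.
by rewrite -memv0 -S0 mem_ker -y0.
Qed.

Lemma mul_pow_eq0 S k : lr_mul S = 0%VS -> lr_mul (lr_pow S k) = 0%VS.
Proof.
move=> S0; elim: k => [|k IH]; apply/vspaceP => x; rewrite memv0 mem_mul.
  by rewrite mem_pow0 eq_sym.
apply/mem_powS/eqP => [[y]|->]; last by exists 0; rewrite ?mem0v.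
rewrite -mem_mul IH memv0 => /eqP-> xy; apply/eqP.
by rewrite -memv0 -S0 mem_mul.
Qed.

Lemma ran_pow_full S k : lr_ran S = fullv -> lr_ran (lr_pow S k) = fullv.
Proof.
move=> Sf; elim: k => [|k IH]; apply/vspaceP => x; rewrite memvf.
  by apply/mem_ran; exists x; rewrite mem_pow0.
have /mem_ran[y yx] : x \in lr_ran S by rewrite Sf memvf.
have /mem_ran[z zy] : y \in lr_ran (lr_pow S k) by rewrite IH memvf.
by apply/mem_ran; exists z; apply/mem_powS; exists y.
Qed.

Lemma qdim_full (U V : {vspace X}) : V = fullv -> qdim U V = 0%N.
Proof. by move=> ->; apply/eqP; rewrite subn_eq0 dimvS ?subvf. Qed.

(** The ranges of all powers are then the whole space, and both spaces in each
    quotient contain them. *)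
Lemma C_num_ran_full S k : lr_ran S = fullv -> C_num S k = 0%N.
Proof.
move=> Sf; have full U : (fullv + U)%VS = fullv :> {vspace X}.
  by apply: addv_idPl; apply: subvf.
by rewrite /C_num !ran_pow_full // Sf; case: ifP => _; apply: qdim_full.
Qed.

Lemma chainspace_eq0 S : rootspace S 0 = 0%VS -> chainspace S = 0%VS.
Proof. by rewrite /chainspace => ->; rewrite cap0v. Qed.

Lemma chainspace_eq0_mul S : lr_mul S = 0%VS -> chainspace S = 0%VS.
Proof.
by move=> S0; rewrite /chainspace /rootspace_oo mul_pow_eq0 // capv0.
Qed.

Lemma B_num_chainspace0 S k : chainspace S = 0%VS -> B_num S k = 0%N.
Proof. by move=> S0; rewrite /B_num S0 !capv0 /qdim subnn. Qed.

Lemma A_num_mul0 S k : lr_mul S = 0%VS -> A_num S k = 0%N.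
Proof. by move=> S0; rewrite /A_num !mul_pow_eq0 // /qdim subnn. Qed.

Lemma W_num_ker0 S l k : lr_ker (lr_shift S l) = 0%VS -> W_num S l k = 0%N.
Proof. by move=> S0; rewrite /W_num !ker_pow_eq0 // /qdim subnn. Qed.

(** W and A are dimensions modulo the chain space. *)
Lemma WA_num_chainspace_full S l k :
  chainspace S = fullv -> W_num S l k = 0%N /\ A_num S k = 0%N.
Proof.
have full U : (U + fullv)%VS = fullv :> {vspace X}.
  by apply: addv_idPr; apply: subvf.
by move=> Sf; split; rewrite /W_num /A_num Sf; apply: qdim_full.
Qed.

(** The spaces N((S - l)^k) + R_c increase from R_c to R_l + R_c, and the
    numbers W_k(l) are the jumps of their dimensions; no jump occurs exactly
    when R_l is contained in R_c, for instance when N(S - l) = 0. *)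
Lemma proper_eigenvalueP S l :
  reflect (exists k, W_num S l k != 0%N) (proper_eigenvalue S l).
Proof.
set Rc := chainspace S; pose N k := lr_ker (lr_pow (lr_shift S l) k).
apply: (iffP andP) => [[_ nsub]|[k Wk]]; last first.
  have [k0 subk] : exists k, ~~ (N k <= Rc)%VS.
    exists k; apply: contra Wk => sub.
    rewrite subn_eq0 dimvS // subv_add addvSr andbT.
    exact: subv_trans sub (addvSr _ _).
  split; last first.
    apply: contra subk; apply: subv_trans; exact: ker_pow_sub_rootspace.
  by apply: contra subk => /eqP S0; rewrite /N ker_pow_eq0 ?sub0v.
(* Without a jump up to \dim {:X}, the dimension at \dim {:X}, where N is the
   root space, is the dimension at 0, where N vanishes. *)
pose d k := \dim (N k + Rc).
have dS k : (d k <= d k.+1)%N by rewrite dimvS // addvS ?ker_pow_mono.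
have [/existsP[k dk]|H] := boolP [exists k : 'I_(\dim {:X}), d k != d k.+1].
  exists k.+1; rewrite subn_eq0 -ltnNge ltn_neqAle dS andbT; exact: dk.
have {H} e k : (k <= \dim {:X})%N -> d k = d 0%N.
  elim: k => // k IH lek; rewrite -IH ?(ltnW lek) //.
  by move/existsPn/(_ (Ordinal lek)): H; rewrite negbK => /eqP <-.
case/negP: nsub; have de := e _ (leqnn _).
have N0 : (N 0%N + Rc)%VS = Rc by rewrite /N ker_powE /= add0v.
have e0 : Rc = (N (\dim {:X}) + Rc)%VS.
  by apply/eqP; rewrite eqEdim addvSr -/(d _) de /d N0 leqnn.
rewrite -/Rc e0; exact: addvSl.
Qed.

End RelationFacts.

(** * Additivity over direct sums *)

Section DirectSum.

Set Implicit Arguments.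
Unset Strict Implicit.

Variables (K : fieldType) (X X1 X2 : vectType K).
Variables (f1 : 'Hom(X, X1)) (f2 : 'Hom(X, X2)) (g : X1 -> X2 -> X).
Hypotheses (f1g : forall x1 x2, f1 (g x1 x2) = x1)
           (f2g : forall x1 x2, f2 (g x1 x2) = x2)
           (gf : forall x, g (f1 x) (f2 x) = x).

(** X is the direct sum of X1 and X2, with projections [f1], [f2] and assembly
    map [g].  [vsplits] and [rsplits] say that a subspace, or a relation,
    corresponds to the product of one on X1 and one on X2. *)
Definition vsplits (U : {vspace X}) (U1 : {vspace X1}) (U2 : {vspace X2}) :=
  forall x, (x \in U) = (f1 x \in U1) && (f2 x \in U2).

Definition rsplits (S : {vspace X * X}) (S1 : {vspace X1 * X1})
    (S2 : {vspace X2 * X2}) :=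
  forall x y, ((x, y) \in S) = ((f1 x, f1 y) \in S1) && ((f2 x, f2 y) \in S2).

Lemma fg_inj x y : f1 x = f1 y -> f2 x = f2 y -> x = y.
Proof. by move=> e1 e2; rewrite -[x]gf -[y]gf e1 e2. Qed.

(** The image of U under [f1] is U1, and [f2] maps the kernel of [f1] on U
    isomorphically onto U2. *)
Lemma vsplits_dim U U1 U2 :
  vsplits U U1 U2 -> \dim U = (\dim U1 + \dim U2)%N.
Proof.
move=> sp; rewrite -(limg_ker_dim f1 U) addnC; congr (_ + _)%N.
  congr (\dim _); apply/vspaceP => x; apply/memv_imgP/idP => [[u]|xU].
    by rewrite sp => /andP[? _] ->.
  by exists (g x 0); rewrite ?f1g // sp f1g f2g xU mem0v.
rewrite -(@limg_dim_eq _ _ _ f2); last first.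
  apply/vspaceP => x; rewrite !memv_cap !memv_ker memv0.
  apply/andP/eqP => [[/andP[_ /eqP x1] /eqP x2]|->].
    by apply: fg_inj; rewrite ?linear0.
  by rewrite !linear0 mem0v !eqxx.
congr (\dim _); apply/vspaceP => x; apply/memv_imgP/idP => [[u]|xU].
  by rewrite memv_cap sp => /andP[/andP[_ ?] _] ->.
by exists (g 0 x); rewrite ?f2g // memv_cap sp memv_ker f1g f2g xU mem0v eqxx.
Qed.

Lemma vsplits_full : vsplits fullv fullv fullv.
Proof. by move=> x; rewrite !memvf. Qed.

Lemma vsplits_cap U U1 U2 V V1 V2 : vsplits U U1 U2 -> vsplits V V1 V2 ->
  vsplits (U :&: V) (U1 :&: V1) (U2 :&: V2).
Proof. by move=> sU sV x; rewrite !memv_cap sU sV andbACA. Qed.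

Lemma vsplits_add U U1 U2 V V1 V2 : vsplits U U1 U2 -> vsplits V V1 V2 ->
  vsplits (U + V) (U1 + V1) (U2 + V2).
Proof.
move=> sU sV x; apply/memv_addP/andP.
  case=> u; rewrite sU => /andP[u1 u2] [v]; rewrite sV => /andP[v1 v2] ->.
  by rewrite !linearD; split; apply: memv_add.
case=> /memv_addP[u1 U1u [v1 V1v e1]] /memv_addP[u2 U2u [v2 V2v e2]].
exists (g u1 u2); first by rewrite sU f1g f2g U1u.
exists (g v1 v2); first by rewrite sV f1g f2g V1v.
by apply: fg_inj; rewrite linearD /= !(f1g, f2g).
Qed.

(** The inclusions matter because [qdim] is a truncated subtraction. *)
Lemma vsplits_qdim U U1 U2 V V1 V2 : vsplits U U1 U2 -> vsplits V V1 V2 ->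
  (V1 <= U1)%VS -> (V2 <= U2)%VS -> qdim U V = (qdim U1 V1 + qdim U2 V2)%N.
Proof.
move=> /vsplits_dim dU /vsplits_dim dV /dimvS d1 /dimvS d2.
by rewrite /qdim dU dV; lia.
Qed.

Lemma rsplits_ker S S1 S2 :
  rsplits S S1 S2 -> vsplits (lr_ker S) (lr_ker S1) (lr_ker S2).
Proof. by move=> sp x; rewrite !mem_ker sp !linear0. Qed.

Lemma rsplits_mul S S1 S2 :
  rsplits S S1 S2 -> vsplits (lr_mul S) (lr_mul S1) (lr_mul S2).
Proof. by move=> sp x; rewrite !mem_mul sp !linear0. Qed.

Lemma rsplits_dom S S1 S2 :
  rsplits S S1 S2 -> vsplits (lr_dom S) (lr_dom S1) (lr_dom S2).
Proof.
move=> sp x; apply/mem_dom/andP => [[y]|[/mem_dom[y1 h1] /mem_dom[y2 h2]]].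
  by rewrite sp => /andP[? ?]; split; apply/mem_dom; eexists; eassumption.
by exists (g y1 y2); rewrite sp f1g f2g h1.
Qed.

Lemma rsplits_ran S S1 S2 :
  rsplits S S1 S2 -> vsplits (lr_ran S) (lr_ran S1) (lr_ran S2).
Proof.
move=> sp x; apply/mem_ran/andP => [[y]|[/mem_ran[y1 h1] /mem_ran[y2 h2]]].
  by rewrite sp => /andP[? ?]; split; apply/mem_ran; eexists; eassumption.
by exists (g y1 y2); rewrite sp f1g f2g h1.
Qed.

Lemma rsplits_shift S S1 S2 l : rsplits S S1 S2 ->
  rsplits (lr_shift S l) (lr_shift S1 l) (lr_shift S2 l).
Proof. by move=> sp x y; rewrite !mem_shiftD sp !linearD !linearZ. Qed.

Lemma rsplits_pow S S1 S2 k : rsplits S S1 S2 ->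
  rsplits (lr_pow S k) (lr_pow S1 k) (lr_pow S2 k).
Proof.
move=> sp; elim: k => [|k IH] x y.
  rewrite !mem_pow0; apply/eqP/andP => [->//|[/eqP ? /eqP ?]].
  exact: fg_inj.
apply/mem_powS/andP => [[z]|].
  rewrite IH sp => /andP[? ?] /andP[? ?].
  by split; apply/mem_powS; eexists; eassumption.
case=> /mem_powS[z1 p1 q1] /mem_powS[z2 p2 q2].
by exists (g z1 z2); rewrite (IH, sp) f1g f2g ?p1 ?q1.
Qed.

Lemma dim_summands : (\dim {:X1} <= \dim {:X})%N /\ (\dim {:X2} <= \dim {:X})%N.
Proof. by rewrite (vsplits_dim vsplits_full) leq_addr leq_addl. Qed.

Lemma rsplits_rootspace S S1 S2 l : rsplits S S1 S2 ->
  vsplits (rootspace S l) (rootspace S1 l) (rootspace S2 l).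
Proof.
have [le1 le2] := dim_summands.
move=> sp; rewrite (rootspaceE _ _ le1) (rootspaceE _ _ le2).
exact: rsplits_ker (rsplits_pow _ (rsplits_shift l sp)).
Qed.

Lemma rsplits_rootspace_oo S S1 S2 : rsplits S S1 S2 ->
  vsplits (rootspace_oo S) (rootspace_oo S1) (rootspace_oo S2).
Proof.
have [le1 le2] := dim_summands.
move=> sp; rewrite (rootspace_ooE _ le1) (rootspace_ooE _ le2).
exact: rsplits_mul (rsplits_pow _ sp).
Qed.

Lemma rsplits_chainspace S S1 S2 : rsplits S S1 S2 ->
  vsplits (chainspace S) (chainspace S1) (chainspace S2).
Proof.
move=> sp; apply: vsplits_cap; first exact: rsplits_rootspace.
exact: rsplits_rootspace_oo.
Qed.

Variables (S : {vspace X * X}) (S1 : {vspace X1 * X1}) (S2 : {vspace X2 * X2}).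
Hypothesis sp : rsplits S S1 S2.

Lemma W_num_split l k : W_num S l k = (W_num S1 l k + W_num S2 l k)%N.
Proof.
have spc := rsplits_chainspace sp.
have spk j := rsplits_ker (rsplits_pow j (rsplits_shift l sp)).
apply: vsplits_qdim; try exact: vsplits_add;
  by rewrite addvS // ker_pow_mono // leq_pred.
Qed.

Lemma A_num_split k : A_num S k = (A_num S1 k + A_num S2 k)%N.
Proof.
have spc := rsplits_chainspace sp.
have spk j := rsplits_mul (rsplits_pow j sp).
apply: vsplits_qdim; try exact: vsplits_add;
  by rewrite addvS // mul_pow_mono // leq_pred.
Qed.

Lemma B_num_split k : B_num S k = (B_num S1 k + B_num S2 k)%N.
Proof.
have spc := rsplits_chainspace sp.
have spk j := rsplits_ker (rsplits_pow j sp).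
apply: vsplits_qdim; try exact: vsplits_cap;
  by rewrite capvS // ker_pow_mono // leq_pred.
Qed.

Lemma C_num_split k : C_num S k = (C_num S1 k + C_num S2 k)%N.
Proof.
have spr := rsplits_rootspace 0 sp.
rewrite /C_num; case: ifP => _; apply: vsplits_qdim.
- exact: vsplits_add (rsplits_ran sp) (rsplits_dom sp).
- exact: vsplits_add (rsplits_ran sp) spr.
- exact: addvS (subvv _) (rootspace_sub_dom _).
- exact: addvS (subvv _) (rootspace_sub_dom _).
- exact: vsplits_add (rsplits_ran (rsplits_pow _ sp)) spr.
- exact: vsplits_add (rsplits_ran (rsplits_pow _ sp)) spr.
- by rewrite addvS // ran_pow_mono.
- by rewrite addvS // ran_pow_mono.
Qed.

End DirectSum.

(** * Block diagonal pencils *)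

Section Pencils.

Set Implicit Arguments.
Unset Strict Implicit.

Variable K : fieldType.

Definition direct_sum (X X1 X2 : vectType K) S S1 S2 : Prop :=
  exists (f1 : 'Hom(X, X1)) (f2 : 'Hom(X, X2)) (g : X1 -> X2 -> X),
    [/\ forall x1 x2, f1 (g x1 x2) = x1, forall x1 x2, f2 (g x1 x2) = x2,
        forall x, g (f1 x) (f2 x) = x & rsplits f1 f2 S S1 S2].

(** Quantifying over all spaces lets one induction over a list of blocks serve
    all the Weyr numbers at once. *)
Definition additive_number (N : forall X : vectType K, {vspace X * X} -> nat) :=
  forall (X X1 X2 : vectType K) S S1 S2,
    @direct_sum X X1 X2 S S1 S2 -> N X S = (N X1 S1 + N X2 S2)%N.

Lemma W_num_additive l k : additive_number (fun X S => W_num S l k).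
Proof. by move=> X X1 X2 S S1 S2 [f1 [f2 [g []]]] *; apply: W_num_split. Qed.

Lemma A_num_additive k : additive_number (fun X S => A_num S k).
Proof. by move=> X X1 X2 S S1 S2 [f1 [f2 [g []]]] *; apply: A_num_split. Qed.

Lemma B_num_additive k : additive_number (fun X S => B_num S k).
Proof. by move=> X X1 X2 S S1 S2 [f1 [f2 [g []]]] *; apply: B_num_split. Qed.

Lemma C_num_additive k : additive_number (fun X S => C_num S k).
Proof. by move=> X X1 X2 S S1 S2 [f1 [f2 [g []]]] *; apply: C_num_split. Qed.

(** The coefficients of sE - F are recovered from its values at 0 and 1, so that
    a block can be handled as a function of s, as in [bdiag]. *)
Definition pencil_rel n m (P : K -> 'M[K]_(n, m)) :=
  range_rep (P 1 - P 0) (- P 0).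

Lemma pencil_relE n m (P : K -> 'M[K]_(n, m)) E F :
  (forall s, P s = s *: E - F) -> pencil_rel P = range_rep E F.
Proof.
by move=> e; rewrite /pencil_rel !e scale1r scale0r sub0r opprK addrNK.
Qed.

Lemma direct_sum_block n1 m1 n2 m2 (P : K -> 'M[K]_(n1, m1))
    (Q : K -> 'M[K]_(n2, m2)) :
  direct_sum (pencil_rel (fun s => block_mx (P s) 0 0 (Q s)))
    (pencil_rel P) (pencil_rel Q).
Proof.
pose f1 := linfun (usubmx : 'cV[K]_(n1 + n2) -> 'cV[K]_n1).
pose f2 := linfun (dsubmx : 'cV[K]_(n1 + n2) -> 'cV[K]_n2).
have f1E x : f1 x = usubmx x.
  by apply: linfunE => a u v; apply/matrixP => i j; rewrite !mxE.
have f2E x : f2 x = dsubmx x.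
  by apply: linfunE => a u v; apply/matrixP => i j; rewrite !mxE.
exists f1, f2, (fun x1 x2 => col_mx x1 x2); split=> [x1 x2|x1 x2|x|u v].
- by rewrite f1E col_mxKu.
- by rewrite f2E col_mxKd.
- by rewrite f1E f2E vsubmxK.
rewrite !f1E !f2E /pencil_rel !opp_block_mx !add_block_mx !oppr0 !addr0.
apply/mem_range_rep/andP => [[x [-> ->]]|].
  rewrite -[x]vsubmxK !mul_block_col !mul0mx !addr0 !add0r.
  rewrite !col_mxKu !col_mxKd.
  by split; apply/mem_range_rep; [exists (usubmx x) | exists (dsubmx x)].
case=> /mem_range_rep[x [ux vx]] /mem_range_rep[y [uy vy]].
exists (col_mx x y); rewrite !mul_block_col !mul0mx !addr0 !add0r.
by rewrite -ux -vx -uy -vy !vsubmxK.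
Qed.

Section AdditiveNumber.

Variable N : forall X : vectType K, {vspace X * X} -> nat.
Hypothesis addN : additive_number N.

(** A relation on the zero space is the direct sum of two copies of itself, so
    its number N satisfies N = N + N. *)
Lemma additive_number_dim0 (S : {vspace 'cV[K]_0 * 'cV[K]_0}) : N S = 0%N.
Proof.
have : direct_sum S S S.
  exists \1%VF, \1%VF, (fun x _ => x).
  split=> [x y|x y|x|x y]; rewrite !id_lfunE ?andbb //.
  by rewrite [x]flatmx0 [y]flatmx0.
by move/addN; lia.
Qed.

(** U only reparametrizes the range representation and V is an isomorphism of
    relations, which is the case of a direct sum with a zero-dimensional second
    summand. *)
Lemma additive_number_equiv n m (E F : 'M[K]_(n, m)) V U :
    V \in unitmx -> U \in unitmx ->
  N (range_rep E F) = N (range_rep (V *m E *m U) (V *m F *m U)).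
Proof.
move=> Vu Uu; pose f := linfun (mulmx V : 'cV[K]_n -> 'cV[K]_n).
have fE x : f x = V *m x by exact: lfunE.
suff /addN -> : direct_sum (range_rep E F)
    (range_rep (V *m E *m U) (V *m F *m U))
    (fullv : {vspace 'cV[K]_0 * 'cV[K]_0}).
  by rewrite additive_number_dim0 addn0.
exists f, 0%R, (fun y _ => invmx V *m y); split=> [x y|x y|x|x y].
- by rewrite fE mulKVmx.
- by rewrite [y]flatmx0 [LHS]flatmx0.
- by rewrite fE mulKmx.
rewrite memvf andbT !fE; apply/mem_range_rep/mem_range_rep => -[z].
  case=> -> ->; exists (invmx U *m z).
  by rewrite -!mulmxA !mulKVmx.
case=> ex ey; exists (U *m z).
by rewrite -[x](mulKmx Vu) -[y](mulKmx Vu) ex ey -!mulmxA !mulKmx.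
Qed.

Lemma additive_number_bdiag (bs : seq (mxfun K)) :
  N (pencil_rel (bdiag bs)) = (\sum_(b <- bs) N (pencil_rel (mf_val b)))%N.
Proof.
elim: bs => [|b bs IH]; first by rewrite big_nil additive_number_dim0.
rewrite big_cons -IH; apply: addN; exact: direct_sum_block.
Qed.

Lemma additive_number_kronecker n m (E F : 'M[K]_(n, m)) js al be ga :
    kronecker_form E F js al be ga ->
  N (range_rep E F) =
    (N (range_rep 1%:M (jordan_mx js))
     + (\sum_(k <- al) N (range_rep (N_mx K k) 1%:M)
        + (\sum_(k <- be) N (range_rep (K_mx K k) (L_mx K k))
           + \sum_(k <- ga) N (range_rep (K_mx K k)^T (L_mx K k)^T))))%N.
Proof.
case=> _ _ [en [em [V [U [Vu Uu eP]]]]].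
have -> : N (range_rep E F) =
    N (pencil_rel (bdiag (kronecker_blocks js al be ga))).
  rewrite (additive_number_equiv E F Vu Uu).
  rewrite -(@pencil_relE _ _ (fun s => V *m pencil E F s *m U)); last first.
    by move=> s; rewrite /pencil mulmxBr mulmxBl -scalemxAr -scalemxAl.
  rewrite /pencil_rel !eP; clear; case: _ / en; case: _ / em.
  by rewrite !castmx_id.
rewrite additive_number_bdiag /kronecker_blocks big_cons !big_cat !big_map /=.
congr (_ + (_ + (_ + _)))%N; try (apply: eq_bigr => k _); congr (N _);
  apply: pencil_relE => // s.
by rewrite scalemx1.
Qed.

End AdditiveNumber.

End Pencils.

(** * Coordinates of column vectors *)

Section Coordinates.

Set Implicit Arguments.
Unset Strict Implicit.

Variable K : fieldType.

Lemma dim_fullcV n : \dim {:'cV[K]_n} = n.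
Proof. by rewrite dimvf dim_matrix mulr1. Qed.

(** In a full rank factorization A = C R the map R is onto and C is injective,
    so A has the same image as C, of dimension the number of columns of C. *)
Lemma dim_limg_mulmx n m (A : 'M[K]_(n, m)) :
  \dim (limg (linfun (mulmx A : 'cV[K]_m -> 'cV[K]_n))) = \rank A.
Proof.
have -> : limg (linfun (mulmx A : 'cV[K]_m -> 'cV[K]_n)) =
          limg (linfun (mulmx (col_base A) : 'cV[K]_(\rank A) -> 'cV[K]_n)).
  apply/vspaceP => y; apply/memv_imgP/memv_imgP => -[x _ ->]; rewrite lfunE /=.
    exists (row_base A *m x); rewrite ?memvf // lfunE /=.
    by rewrite mulmxA mulmx_base.
  exists (pinvmx (row_base A) *m x); rewrite ?memvf // lfunE /=.
  transitivity (col_base A *m row_base A *m (pinvmx (row_base A) *m x)).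
    by rewrite -mulmxA (mulmxA (row_base A)) mulmxVp ?row_base_free // mul1mx.
  by rewrite mulmx_base.
rewrite limg_dim_eq; first exact: dim_fullcV.
apply/vspaceP => x; rewrite memv_cap memvf memv_ker memv0 lfunE /=.
apply/eqP/eqP => [Ax|->]; last by rewrite mulmx0.
by rewrite -[x]mul1mx -(mulVpmx (col_base_full A)) -mulmxA Ax mulmx0.
Qed.

Lemma dim_lker_mulmx n (A : 'M[K]_n) :
  \dim (lker (linfun (mulmx A : 'cV[K]_n -> 'cV[K]_n))) = nullity A.
Proof.
rewrite /nullity mxrank_coker -dim_limg_mulmx.
have := limg_ker_dim (linfun (mulmx A : 'cV[K]_n -> 'cV[K]_n)) fullv.
by rewrite dim_fullcV capfv => e; rewrite -[X in (X - _)%N]e addnK.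
Qed.

(** Coordinates indexed by all naturals, zero beyond the last one: shifting an
    index then needs no proof that it stays in range. *)
Definition coef n (x : 'cV[K]_n) (i : nat) : K :=
  if insub i is Some j then x j 0 else 0.

Lemma coef_ord n (x : 'cV[K]_n) (i : 'I_n) : coef x i = x i 0.
Proof. by rewrite /coef valK. Qed.

Lemma coef_out n (x : 'cV[K]_n) i : (n <= i)%N -> coef x i = 0.
Proof. by move=> le; rewrite /coef insubN // -leqNgt. Qed.

Lemma coef_inj n (x y : 'cV[K]_n) : coef x =1 coef y -> x = y.
Proof. by move=> e; apply/colP => i; rewrite -!coef_ord e. Qed.

Lemma coef0 n i : coef (0 : 'cV[K]_n) i = 0.
Proof. by rewrite /coef; case: insub => // j; rewrite mxE. Qed.

Lemma coef_lin n a (x y : 'cV[K]_n) i :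
  coef (x + a *: y) i = coef x i + a * coef y i.
Proof.
by rewrite /coef; case: insub => [j|]; rewrite ?mxE ?mulr0 ?addr0.
Qed.

Lemma coef_col n (f : nat -> K) i :
  coef (\col_(i < n) f i) i = if (i < n)%N then f i else 0.
Proof.
by rewrite /coef; case: insubP => [j -> <-|/negPf-> //]; rewrite mxE.
Qed.

Lemma sum_delta n (x : 'cV[K]_n) k :
  \sum_(j < n) (k == j :> nat)%:R * x j 0 = coef x k.
Proof.
have [lt|le] := ltnP k n; last first.
  rewrite coef_out // big1 // => j _.
  by rewrite gtn_eqF ?mul0r // (leq_trans (ltn_ord j)).
rewrite (bigD1 (Ordinal lt)) //= eqxx mul1r big1 => [|j ne].
  by rewrite addr0 -coef_ord.
by rewrite -val_eqE /= eq_sym in ne; rewrite (negPf ne) mul0r.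
Qed.

Lemma coef_mul n m (A : 'M[K]_(n, m)) x i :
  coef (A *m x) i = if insub i is Some i' then \sum_j A i' j * x j 0 else 0.
Proof. by rewrite /coef; case: insub => // j; rewrite mxE. Qed.

Lemma coef_pid n (x : 'cV[K]_n) k i :
  coef ((pid_mx k : 'M_n) *m x) i = if (i < k)%N then coef x i else 0.
Proof.
rewrite coef_mul; case: insubP => [i' _ <-|ni]; last first.
  by rewrite (coef_out x) ?if_same // leqNgt.
transitivity (\sum_(j < n) ((i' == j :> nat) && (i' < k)%N)%:R * x j 0).
  by apply: eq_bigr => j _; rewrite mxE.
case: ifP => _; first by under eq_bigr do rewrite andbT; apply: sum_delta.
by rewrite big1 // => j _; rewrite andbF mul0r.
Qed.

Lemma coef_N n (x : 'cV[K]_n) i :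
  coef (N_mx K n *m x) i =
    if i is i'.+1 then (if (i < n)%N then coef x i' else 0) else 0.
Proof.
rewrite coef_mul; case: insubP => [j ltj <-|ni]; last first.
  by case: i ni => // i /negPf->.
under eq_bigr do rewrite mxE.
case: j ltj => -[|j] /= lt _; last first.
  by rewrite lt -sum_delta; apply: eq_bigr => k _; rewrite eqSS.
by rewrite big1 // => k _; rewrite mul0r.
Qed.

Lemma coef_K d (x : 'cV[K]_d.+1) i :
  coef (K_mx K d.+1 *m x) i = if (i < d)%N then coef x i else 0.
Proof.
rewrite coef_mul; case: insubP => [j _ <-|/negPf-> //].
have ltj : (j < d)%N := ltn_ord j.
rewrite /= ltj -sum_delta; apply: eq_bigr => k _; by rewrite mxE eq_sym.
Qed.

Lemma coef_L d (x : 'cV[K]_d.+1) i :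
  coef (L_mx K d.+1 *m x) i = if (i < d)%N then coef x i.+1 else 0.
Proof.
rewrite coef_mul; case: insubP => [j _ <-|/negPf-> //].
have ltj : (j < d)%N := ltn_ord j.
rewrite /= ltj -sum_delta; apply: eq_bigr => k _; by rewrite mxE eq_sym.
Qed.

Lemma coef_Ktr d (x : 'cV[K]_d) i : coef ((K_mx K d.+1)^T *m x) i = coef x i.
Proof.
rewrite coef_mul; case: insubP => [j /= ltj <-|].
  by rewrite -sum_delta; apply: eq_bigr => k _; rewrite !mxE.
by rewrite -leqNgt => le; rewrite coef_out // ltnW.
Qed.

Lemma coef_Ltr d (x : 'cV[K]_d) i :
  coef ((L_mx K d.+1)^T *m x) i = if i is i'.+1 then coef x i' else 0.
Proof.
rewrite coef_mul; case: insubP => [j ltj <-|].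
  case: j ltj => -[|j] lt _ /=; last first.
    by rewrite -sum_delta; apply: eq_bigr => k _; rewrite !mxE eqSS.
  by rewrite big1 // => k _; rewrite !mxE mul0r.
by rewrite -leqNgt; case: i => // i le; rewrite coef_out.
Qed.

(** The coordinate subspaces spanned by the first k basis vectors and by all but
    the first k, as image and kernel of the truncation to the first k
    coordinates; this gives their dimensions as a rank and a nullity. *)
Definition lowspace n k : {vspace 'cV[K]_n} :=
  limg (linfun (mulmx (pid_mx k) : 'cV[K]_n -> 'cV[K]_n)).

Definition highspace n k : {vspace 'cV[K]_n} :=
  lker (linfun (mulmx (pid_mx k) : 'cV[K]_n -> 'cV[K]_n)).

Lemma rank_pid_min n k : \rank (pid_mx k : 'M[K]_n) = minn n k.
Proof. by rewrite -pid_mx_minv rank_pid_mx // geq_minl. Qed.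

Lemma dim_lowspace n k : \dim (lowspace n k) = minn n k.
Proof. by rewrite dim_limg_mulmx rank_pid_min. Qed.

Lemma dim_highspace n k : \dim (highspace n k) = (n - k)%N.
Proof. by rewrite dim_lker_mulmx /nullity mxrank_coker rank_pid_min; lia. Qed.

Lemma mem_lowspace n k (x : 'cV[K]_n) :
  reflect (forall i, (k <= i)%N -> coef x i = 0) (x \in lowspace n k).
Proof.
apply: (iffP idP) => [/memv_imgP[y _ ->] i le|x0].
  by rewrite lfunE coef_pid ltnNge le.
apply/memv_imgP; exists x; rewrite ?memvf // lfunE; apply: coef_inj => i.
by rewrite coef_pid; case: ltnP => // /x0.
Qed.

Lemma mem_highspace n k (x : 'cV[K]_n) :
  reflect (forall i, (i < k)%N -> coef x i = 0) (x \in highspace n k).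
Proof.
rewrite memv_ker lfunE /=; apply: (iffP idP) => [/eqP x0 i lt|x0].
  by have := coef_pid x k i; rewrite lt x0 coef0.
apply/eqP/coef_inj => i; rewrite coef_pid coef0.
by case: ltnP => // /x0.
Qed.

End Coordinates.

(** * The four kinds of blocks *)

Section Blocks.

Set Implicit Arguments.
Unset Strict Implicit.

Variable K : fieldType.

Section Graph.

Variables (n : nat) (J : 'M[K]_n).

Lemma mem_graph (A : 'M[K]_n) x y :
  ((x, y) \in range_rep 1%:M A) = (y == A *m x).
Proof.
apply/mem_range_rep/eqP => [[z [-> ->]]|->]; first by rewrite mul1mx.
by exists x; rewrite mul1mx.
Qed.

Lemma graph_shift l :
  lr_shift (range_rep 1%:M J) l = range_rep 1%:M (J - l%:M).
Proof.
apply/vspaceP => -[x y]; rewrite mem_shiftD !mem_graph mulmxBl.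
by rewrite mul_scalar_mx -subr_eq opprK.
Qed.

Lemma mem_graph_pow (A : 'M[K]_n) k x y :
  ((x, y) \in lr_pow (range_rep 1%:M A) k) = (y == A ^+ k *m x).
Proof.
elim: k x y => [|k IH] x y; first by rewrite mem_pow0 expr0 mul1mx eq_sym.
rewrite exprS -mulmxE -mulmxA; apply/mem_powS/eqP => [[z]|->].
  by rewrite IH mem_graph => /eqP-> /eqP.
by exists (A ^+ k *m x); rewrite ?IH ?mem_graph.
Qed.

Lemma dim_ker_graph_pow (A : 'M[K]_n) k :
  \dim (lr_ker (lr_pow (range_rep 1%:M A) k)) = nullity (A ^+ k).
Proof.
rewrite -dim_lker_mulmx; congr (\dim _); apply/vspaceP => x.
by rewrite mem_ker mem_graph_pow memv_ker lfunE eq_sym.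
Qed.

Lemma graph_mul : lr_mul (range_rep 1%:M J) = 0%VS.
Proof. by apply/vspaceP => y; rewrite mem_mul mem_graph mulmx0 memv0. Qed.

Lemma W_num_graph l k : W_num (range_rep 1%:M J) l k = w_num J l k.
Proof.
rewrite /W_num chainspace_eq0_mul ?graph_mul // !addv0 graph_shift.
by rewrite /qdim !dim_ker_graph_pow.
Qed.

Lemma A_num_graph k : A_num (range_rep 1%:M J) k = 0%N.
Proof. exact: A_num_mul0 graph_mul. Qed.

Lemma B_num_graph k : B_num (range_rep 1%:M J) k = 0%N.
Proof. exact: B_num_chainspace0 (chainspace_eq0_mul graph_mul). Qed.

(** Fitting: for d at least the dimension, J^d x = J^(d + k) y for some y, and
    x = J^k y + (x - J^k y) with the second term killed by J^d. *)
Lemma graph_fitting k :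
  (lr_ran (lr_pow (range_rep 1%:M J) k) + rootspace (range_rep 1%:M J) 0)%VS
    = fullv.
Proof.
set S := range_rep 1%:M J; apply/vspaceP => x; rewrite memvf.
pose d := \dim {:'cV[K]_n}.
have : J ^+ d *m x \in lr_ran (lr_pow S (d + k)).
  rewrite ran_pow_stable ?leq_addr //; apply/mem_ran.
  by exists x; rewrite mem_graph_pow.
case/mem_ran => y; rewrite mem_graph_pow exprD -mulmxE -mulmxA => /eqP exy.
rewrite -[x](addrNK (J ^+ k *m y)) addrC; apply: memv_add.
  by apply/mem_ran; exists y; rewrite mem_graph_pow.
rewrite /rootspace shift0 mem_ker mem_graph_pow mulmxBr -/d exy.
by rewrite subrr.
Qed.

Lemma C_num_graph k : C_num (range_rep 1%:M J) k = 0%N.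
Proof.
rewrite /C_num; case: ifP => _; apply: qdim_full; last exact: graph_fitting.
by rewrite -(graph_fitting 1) pow1.
Qed.

(** Both sides say that J - l is singular: the nullities of its powers start
    from 0, and all of them vanish when it is invertible. *)
Lemma eigenvalue_w_numP l :
  reflect (exists k, w_num J l k != 0%N) (eigenvalue J l).
Proof.
have -> : eigenvalue J l = ((J - l%:M) \notin unitmx).
  by rewrite /eigenvalue /eigenspace kermx_eq0 row_free_unit.
have nullE k : nullity ((J - l%:M) ^+ k) = 0%N <-> (J - l%:M) ^+ k \in unitmx.
  rewrite -row_free_unit /row_free /nullity mxrank_coker.
  split=> [e|/eqP->]; last by rewrite subnn.
  by rewrite eqn_leq rank_leq_row -subn_eq0 e.
apply: (iffP idP) => [nu|[k]].
  exists 1%N; rewrite /w_num expr0 expr1.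
  have -> : nullity (1 : 'M[K]_n) = 0%N by apply/(nullE 0%N); rewrite unitmx1.
  by rewrite subn0; apply: contra nu => /eqP e; apply/(nullE 1%N).
apply: contra => u; rewrite /w_num.
have u' : (J - l%:M) ^+ k \in unitmx.
  by elim: k => [|k IH]; rewrite ?expr0 ?unitmx1 // exprS -mulmxE unitmx_mul u.
by move/(nullE k): u' => ->; rewrite sub0n.
Qed.

End Graph.

Section Nilpotent.

Variable n : nat.
Let S := range_rep (N_mx K n) 1%:M.

Lemma mem_Nrel x y : ((x, y) \in S) = (x == N_mx K n *m y).
Proof.
apply/mem_range_rep/eqP => [[z [-> ->]]|->]; first by rewrite mul1mx.
by exists y; rewrite mul1mx.
Qed.

(** N is nilpotent: x = l N x determines the coordinates of x inductively, all
    of them being 0. *)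
Lemma Nrel_ker l : lr_ker (lr_shift S l) = 0%VS.
Proof.
apply/vspaceP => x; rewrite mem_ker mem_shiftD add0r mem_Nrel memv0.
apply/eqP/eqP => [e|->]; last by rewrite scaler0 mulmx0.
apply: coef_inj => i; rewrite coef0 e.
have [m] := ubnP i; elim: m i => // m IH i lt.
rewrite coef_N; case: i lt => // i lt; case: ifP => // _.
by rewrite -[_ *: x]add0r coef_lin coef0 add0r e IH ?mulr0.
Qed.

(** This is the kernel of N^k: the last k coordinates are free. *)
Lemma Nrel_mul_pow k : lr_mul (lr_pow S k) = highspace K n (n - k).
Proof.
elim: k => [|k IH]; apply/vspaceP => y; rewrite mem_mul.
  rewrite mem_pow0 subn0 eq_sym; apply/eqP/mem_highspace => [-> i _|y0].
    exact: coef0.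
  apply: coef_inj => i; rewrite coef0; case: (ltnP i n) => [/y0//|].
  exact: coef_out.
apply/mem_powS/mem_highspace => [[x]|y0].
  rewrite -mem_mul IH mem_Nrel => /mem_highspace x0 /eqP ex i lt.
  have := x0 i.+1; rewrite ex coef_N.
  have -> : (i.+1 < n)%N by lia.
  by apply; lia.
exists (N_mx K n *m y); rewrite ?mem_Nrel // -mem_mul IH.
apply/mem_highspace => -[|i] lt; rewrite coef_N //.
by case: ifP => // _; apply: y0; lia.
Qed.

Lemma Nrel_ran : lr_ran S = fullv.
Proof.
apply/vspaceP => y; rewrite memvf; apply/mem_ran.
by exists (N_mx K n *m y); rewrite mem_Nrel.
Qed.

Lemma Nrel_chainspace : chainspace S = 0%VS.
Proof. by rewrite chainspace_eq0 // /rootspace ker_pow_eq0 // Nrel_ker. Qed.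

Lemma A_num_Nrel k : (0 < k)%N -> A_num S k = (k <= n)%N.
Proof.
rewrite /A_num Nrel_chainspace !addv0 !Nrel_mul_pow /qdim !dim_highspace.
lia.
Qed.

End Nilpotent.

Section BackwardShift.

Variable d : nat.
Let S := range_rep (K_mx K d.+1) (L_mx K d.+1).

(** The last coordinate of y is the free one. *)
Lemma mem_Krel x y :
  reflect (forall i, (i.+1 < d)%N -> coef y i = coef x i.+1) ((x, y) \in S).
Proof.
apply: (iffP idP) => [/mem_range_rep[z [-> ->]] i lt|e].
  by rewrite coef_K coef_L lt ltnW.
apply/mem_range_rep.
(* The entries of x and the free last entry of y form a vector of length d + 1,
   and dropping its last or its first entry gives x or y. *)
exists (\col_(i < d.+1) (if (i < d)%N then coef x i else coef y i.-1)).
split; apply: coef_inj => i.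
  rewrite coef_K; case: ltnP => le; last by rewrite coef_out.
  rewrite (coef_col _ (fun i => if (i < d)%N then coef x i else coef y i.-1)).
  by rewrite le ltnW.
rewrite coef_L; case: ltnP => le; last by rewrite coef_out.
rewrite (coef_col _ (fun i => if (i < d)%N then coef x i else coef y i.-1)).
by rewrite ltnS le; case: ltnP => // /e ->.
Qed.

(** A chain of length k from x to 0 shifts out the first k coordinates of x, so
    the remaining ones must vanish. *)
Lemma Krel_ker_pow k : lr_ker (lr_pow S k) = lowspace K d k.
Proof.
elim: k => [|k IH]; apply/vspaceP => x; rewrite mem_ker.
  rewrite mem_pow0; apply/eqP/mem_lowspace => [-> i _|x0]; first exact: coef0.
  by apply: coef_inj => i; rewrite coef0 x0.
apply/mem_powSr/mem_lowspace => [[y] /mem_Krel e|x0].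
  rewrite -mem_ker IH => /mem_lowspace y0 -[|i] // le.
  case: (ltnP i.+1 d) => lt; last exact: coef_out.
  by rewrite -e // y0.
exists (\col_(i < d) coef x i.+1).
  by apply/mem_Krel => i lt; rewrite (coef_col _ (fun i => coef x i.+1)) ltnW.
rewrite -mem_ker IH; apply/mem_lowspace => i le.
by rewrite (coef_col _ (fun i => coef x i.+1)); case: ifP => // _; apply: x0.
Qed.

(** A chain from 0 to y feeds the coordinates of y in through the free last
    entry; its previous term is N y, which has one more leading zero. *)
Lemma Krel_mul_pow k : (highspace K d (d - k) <= lr_mul (lr_pow S k))%VS.
Proof.
elim: k => [|k IH]; apply/subvP => y /mem_highspace y0; rewrite mem_mul.
  rewrite mem_pow0 eq_sym; apply/eqP/coef_inj => i; rewrite coef0.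
  by case: (ltnP i d) => lt; [apply: y0; rewrite subn0 | apply: coef_out].
apply/mem_powS; exists (N_mx K d *m y); last first.
  by apply/mem_Krel => i lt; rewrite coef_N lt.
rewrite -mem_mul; apply: (subvP IH); apply/mem_highspace => -[|i] lt.
  by rewrite coef_N.
by rewrite coef_N; case: ifP => // _; apply: y0; lia.
Qed.

(** In at most d steps all coordinates of a vector can be shifted out, and all
    of them can be fed in. *)
Lemma Krel_chainspace : chainspace S = fullv.
Proof.
apply/vspaceP => x; rewrite memvf memv_cap; apply/andP; split.
  rewrite /rootspace shift0 Krel_ker_pow dim_fullcV.
  by apply/mem_lowspace => i le; apply: coef_out.
apply: (subvP (Krel_mul_pow _)); rewrite dim_fullcV subnn.
exact/mem_highspace.
Qed.

Lemma Krel_ran : lr_ran S = fullv.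
Proof.
apply/vspaceP => y; rewrite memvf; apply/mem_ran.
exists (N_mx K d *m y); by apply/mem_Krel => i lt; rewrite coef_N lt.
Qed.

Lemma B_num_Krel k : (0 < k)%N -> B_num S k = (k < d.+1)%N.
Proof.
rewrite /B_num Krel_chainspace !capvf !Krel_ker_pow /qdim !dim_lowspace.
lia.
Qed.

End BackwardShift.

Section ForwardShift.

Variable d : nat.
Let S := range_rep (K_mx K d.+1)^T (L_mx K d.+1)^T.

Lemma mem_Ktrel x y :
  reflect [/\ coef x d = 0, coef y 0%N = 0 & forall i, coef y i.+1 = coef x i]
          ((x, y) \in S).
Proof.
apply: (iffP idP) => [/mem_range_rep[z [-> ->]]|[x0 y0 e]].
  by split=> [||i]; rewrite !(coef_Ktr, coef_Ltr) // coef_out.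
apply/mem_range_rep; exists (\col_(i < d) coef x i).
have e' i : coef (\col_(i < d) coef x i) i = coef x i.
  rewrite coef_col; case: ltnP => //; rewrite leq_eqVlt.
  by case/orP=> [/eqP<-|lt]; rewrite ?x0 // coef_out.
split; apply: coef_inj => i; first by rewrite coef_Ktr e'.
by rewrite coef_Ltr; case: i => // i; rewrite e' e.
Qed.

(** Coordinate by coordinate, (x, l x) being in S reads x_i = l x_(i+1), so
    all entries vanish by descending induction from the last one. *)
Lemma Ktrel_ker l : lr_ker (lr_shift S l) = 0%VS.
Proof.
apply/vspaceP => x; rewrite mem_ker mem_shiftD add0r memv0.
apply/idP/eqP => [/mem_Ktrel[_ _ e]|->]; last by rewrite scaler0 mem0v.
have {}e i : coef x i = l * coef x i.+1.
  by rewrite -e -[_ *: x]add0r coef_lin coef0 add0r.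
apply: coef_inj => i; rewrite coef0.
have [m] := ubnP (d.+1 - i); elim: m i => // m IH i lt.
case: (ltnP i d.+1) => le; last exact: coef_out.
by rewrite e IH ?mulr0 //; lia.
Qed.

Lemma Ktrel_mul : lr_mul S = 0%VS.
Proof.
apply/vspaceP => y; rewrite mem_mul memv0.
apply/idP/eqP => [/mem_Ktrel[_ y0 e]|->]; last exact: mem0v.
by apply: coef_inj => -[|i]; rewrite coef0 // e coef0.
Qed.

Lemma Ktrel_ran_pow k : lr_ran (lr_pow S k) = highspace K d.+1 k.
Proof.
elim: k => [|k IH]; apply/vspaceP => y.
  apply/mem_ran/mem_highspace => [//|_].
  by exists y; rewrite mem_pow0.
apply/mem_ran/mem_highspace => [[x] /mem_powS[z xz /mem_Ktrel[_ y0 e]]|y0].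
  have : z \in lr_ran (lr_pow S k) by apply/mem_ran; exists x.
  by rewrite IH => /mem_highspace z0 -[|i] // lt; rewrite e z0.
pose z := \col_(i < d.+1) (coef y i.+1).
have ez i : coef z i = coef y i.+1.
  rewrite (coef_col _ (fun i => coef y i.+1)); case: ltnP => // le.
  by rewrite coef_out // leqW.
have : z \in lr_ran (lr_pow S k).
  by rewrite IH; apply/mem_highspace => i lt; rewrite ez y0.
case/mem_ran => x xz; exists x; apply/mem_powS; exists z => //.
by apply/mem_Ktrel; split=> [||i]; [rewrite ez coef_out|exact: y0|rewrite ez].
Qed.

Lemma Ktrel_rootspace : rootspace S 0 = 0%VS.
Proof. by rewrite /rootspace ker_pow_eq0 // Ktrel_ker. Qed.

Lemma Ktrel_dom : lr_dom S = lowspace K d.+1 d.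
Proof.
apply/vspaceP => x; apply/mem_dom/mem_lowspace => [[y /mem_Ktrel[x0 _ _]]|x0].
  move=> i; rewrite leq_eqVlt => /orP[/eqP<-//|lt]; exact: coef_out.
exists (N_mx K d.+1 *m x); apply/mem_Ktrel; split; rewrite ?coef_N ?x0 // => i.
rewrite coef_N; case: ltnP => // le; rewrite x0 //; exact: le.
Qed.

Lemma Ktrel_ran : lr_ran S = highspace K d.+1 1.
Proof. by rewrite -Ktrel_ran_pow pow1. Qed.

(** Vectors with first entry 0 and vectors with last entry 0 span everything,
    unless the first entry is the last one. *)
Lemma dim_Ktrel_ran_dom :
  \dim (lr_ran S + lr_dom S) = if d == 0%N then 0%N else d.+1.
Proof.
rewrite Ktrel_ran Ktrel_dom; have [d0|d0] := posnP d.
  have := dimv_sum_cap (highspace K d.+1 1) (lowspace K d.+1 d).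
  rewrite dim_highspace dim_lowspace.
  by move: (\dim (_ + _)) (\dim (_ :&: _)) => u v; lia.
rewrite -[RHS](dim_fullcV K); congr (\dim _); apply/vspaceP => x.
rewrite memvf -[x](addrNK ((pid_mx 1 : 'M_d.+1) *m x)); apply: memv_add.
  apply/mem_highspace => -[|//] _.
  by rewrite -scaleN1r coef_lin coef_pid mulN1r subrr.
by apply/mem_lowspace => i le; rewrite coef_pid ltnNge (leq_trans d0).
Qed.

Lemma C_num_Ktrel k : (0 < k)%N -> C_num S k = (k < d.+1)%N.
Proof.
rewrite /C_num Ktrel_rootspace !addv0 !Ktrel_ran_pow /qdim !dim_highspace.
case: eqP => [-> _|]; last by lia.
by rewrite dim_Ktrel_ran_dom Ktrel_ran dim_highspace; case: eqP; lia.
Qed.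

End ForwardShift.

End Blocks.

(** * Sequences with zero entries omitted *)

Section Sequences.

Set Implicit Arguments.
Unset Strict Implicit.

Implicit Types (f g : nat -> nat) (al : seq nat).

Lemma eq_omit0 d f g :
  (forall k, (0 < k)%N -> f k = g k) -> omit0 d f = omit0 d g.
Proof.
move=> e; congr filter; apply/eq_in_map => k; rewrite mem_iota => /andP[k0 _].
exact: e.
Qed.

Lemma omit0_widen d d' f : (d <= d')%N ->
  (forall k, (d < k)%N -> f k = 0%N) -> omit0 d' f = omit0 d f.
Proof.
move=> le f0; rewrite -(subnKC le) /omit0 iotaD map_cat filter_cat.
rewrite [X in _ ++ X](_ : _ = [::]) ?cats0 //.
apply/eqP; rewrite -(negbK (_ == _)) -has_filter; apply/hasPn => x.
by case/mapP => k; rewrite mem_iota => /andP[lt _] ->; rewrite f0 //; lia.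
Qed.

(** The two sequences are listed up to different bounds, the dimension of the
    ambient space and the size of the partition. *)
Lemma omit0_bound d1 d2 f g :
    (forall k, (0 < k)%N -> f k = g k) ->
    (forall k, (d1 < k)%N -> f k = 0%N) ->
    (forall k, (d2 < k)%N -> g k = 0%N) ->
  omit0 d1 f = omit0 d2 g.
Proof.
move=> e f0 g0; rewrite -(omit0_widen (leq_maxl d1 d2) f0).
rewrite -(omit0_widen (leq_maxr d1 d2) g0); exact: eq_omit0.
Qed.

(** Monotonicity makes the first listed entry g 1: if g 1 = 0 the whole list is
    empty. *)
Lemma behead_omit0 d g :
    (forall j k, (j <= k)%N -> (g k <= g j)%N) ->
    (forall k, (d < k)%N -> g k = 0%N) ->
  behead (omit0 d g) = omit0 d (fun k => g k.+1).
Proof.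
move=> gmono g0.
have -> : omit0 d (fun k => g k.+1) = [seq x <- map g (iota 2 d) | x != 0%N].
  by congr filter; rewrite (iotaDl 1 1) -map_comp.
have [g1|g1] := eqVneq (g 1%N) 0%N.
  have nil s : {subset s <= ltn 0} -> [seq x <- map g s | x != 0%N] = [::].
    move=> s0; apply/eqP; rewrite -(negbK (_ == _)) -has_filter.
    apply/hasPn => _ /mapP[k /s0 k0 ->]; rewrite negbK.
    by rewrite -leqn0 -g1 gmono.
  by rewrite /omit0 !nil // => k; rewrite mem_iota => /andP[lt _];
    apply: leq_trans lt.
rewrite -(omit0_widen (leqnSn d) g0) /omit0 /=.
by rewrite g1.
Qed.

Lemma sum_leq_count al k : (\sum_(x <- al) (k <= x) = count (leq k) al)%N.
Proof. by elim: al => [|x al IH]; rewrite ?big_nil // big_cons IH. Qed.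

Lemma sum_ltn_count al k : (\sum_(x <- al) (k < x) = count (leq k.+1) al)%N.
Proof. exact: sum_leq_count. Qed.

Lemma behead_conj_partition al :
  behead (conj_partition al) = omit0 (sumn al) (fun k => count (leq k.+1) al).
Proof.
apply: (@behead_omit0 _ (fun k => count (leq k) al)) => [j k le|k].
  by apply: sub_count => x; apply: leq_trans.
exact: conj_partition_big.
Qed.

End Sequences.

(** * The Weyr numbers of a pencil in Kronecker form *)

Section KroneckerForm.

Set Implicit Arguments.
Unset Strict Implicit.

Variables (K : fieldType) (n m : nat) (E F : 'M[K]_(n, m)).
Variables (js : seq (K * nat)) (al be ga : seq nat).
Hypothesis kf : kronecker_form E F js al be ga.

Let S := range_rep E F.

Lemma multi_index_pos ks x : multi_index ks -> x \in ks -> (0 < x)%N.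
Proof. by case/andP=> _ /allP pos /pos. Qed.

Lemma kronecker_pos :
  (forall x, x \in be -> 0 < x)%N /\ (forall x, x \in ga -> 0 < x)%N.
Proof. by case: kf => _ [_ b0 g0] _; split=> x; apply: multi_index_pos. Qed.

(** Only the Jordan part contributes to W: the other blocks have no finite
    eigenvalue, or all of their space is chain space. *)
Lemma W_num_pencil l k : W_num S l k = w_num (jordan_mx js) l k.
Proof.
have [b0 g0] := kronecker_pos.
rewrite (additive_number_kronecker (W_num_additive l k) kf) W_num_graph.
rewrite !big1_seq ?addn0 // => x /andP[_].
- by move=> /g0; case: x => // d _; rewrite W_num_ker0 ?Ktrel_ker.
- move=> /b0; case: x => // d _.
  by have [] := WA_num_chainspace_full l k (Krel_chainspace K d).
- by move=> _; rewrite W_num_ker0 ?Nrel_ker.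
Qed.

Lemma A_num_pencil k : (0 < k)%N -> A_num S k = count (leq k) al.
Proof.
move=> k0; have [b0 g0] := kronecker_pos.
rewrite (additive_number_kronecker (A_num_additive k) kf) A_num_graph add0n.
rewrite -sum_leq_count -[RHS]addn0; congr (_ + _)%N.
  by apply: eq_bigr => x _; apply: A_num_Nrel.
rewrite !big1_seq // => x /andP[_].
- by move=> /g0; case: x => // d _; rewrite A_num_mul0 ?Ktrel_mul.
- move=> /b0; case: x => // d _.
  by have [] := WA_num_chainspace_full 0 k (Krel_chainspace K d).
Qed.

Lemma B_num_pencil k : (0 < k)%N -> B_num S k = count (leq k.+1) be.
Proof.
move=> k0; have [b0 g0] := kronecker_pos.
rewrite (additive_number_kronecker (B_num_additive k) kf) B_num_graph add0n.
rewrite big1_seq => [|x _]; last by rewrite B_num_chainspace0 ?Nrel_chainspace.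
rewrite add0n -sum_ltn_count -[RHS]addn0; congr (_ + _)%N.
  by apply: eq_big_seq => -[/b0|d _] //; apply: B_num_Krel.
rewrite big1_seq // => x /andP[_ /g0]; case: x => // d _.
by rewrite B_num_chainspace0 // chainspace_eq0 // Ktrel_rootspace.
Qed.

Lemma C_num_pencil k : (0 < k)%N -> C_num S k = count (leq k.+1) ga.
Proof.
move=> k0; have [b0 g0] := kronecker_pos.
rewrite (additive_number_kronecker (C_num_additive k) kf) C_num_graph add0n.
rewrite big1_seq => [|x _]; last by rewrite C_num_ran_full ?Nrel_ran.
rewrite add0n big1_seq => [|x /andP[_ /b0]]; last first.
  by case: x => // d _; rewrite C_num_ran_full ?Krel_ran.
rewrite add0n -sum_ltn_count.
by apply: eq_big_seq => -[/g0|d _] //; apply: C_num_Ktrel.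
Qed.

Lemma proper_eigenvalue_pencil l :
  proper_eigenvalue S l = eigenvalue (jordan_mx js) l.
Proof.
apply/proper_eigenvalueP/eigenvalue_w_numP => -[k Wk]; exists k.
  by rewrite -W_num_pencil.
by rewrite W_num_pencil.
Qed.

End KroneckerForm.

Theorem weyr_range_rep (K : fieldType) (n m : nat) (E F : 'M[K]_(n, m))
    w a b c :
  weyr_pencil E F w a b c ->
  [/\ weyr_W (range_rep E F) =1 w,
      weyr_A (range_rep E F) = a,
      weyr_B (range_rep E F) = behead b &
      weyr_C (range_rep E F) = behead c].
Proof.
case=> js [al [be [ga [kf ew -> -> ->]]]]; split.
- move=> l; rewrite ew /weyr_W /weyr_w (proper_eigenvalue_pencil kf).
  case: ifP => // _; congr Some; apply: omit0_bound => k.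
  + by rewrite (W_num_pencil kf).
  + exact: W_num_big.
  + exact: w_num_big.
- apply: omit0_bound => k; [exact: (A_num_pencil kf)| exact: A_num_big|].
  exact: conj_partition_big.
- rewrite behead_conj_partition; apply: omit0_bound => k.
  + exact: (B_num_pencil kf).
  + exact: B_num_big.
  + by move=> lt; apply: conj_partition_big; apply: leqW.
- rewrite behead_conj_partition; apply: omit0_bound => k.
  + exact: (C_num_pencil kf).
  + exact: C_num_big.
  + by move=> lt; apply: conj_partition_big; apply: leqW.
Qed.

Theorem theorem6p1 (R : realType) (n m : nat) (E F : 'M[R[i]]_(n, m))
    (w : R[i] -> option (seq nat)) (a b c : seq nat) :
  weyr_pencil E F w a b c ->
  [/\ weyr_W (range_rep E F) =1 w,
      weyr_A (range_rep E F) = a,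
      weyr_B (range_rep E F) = behead b &
      weyr_C (range_rep E F) = behead c].
Proof. exact: weyr_range_rep. Qed.
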